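(* Let $D\subseteq\mathcal{L}(C)$ be a domain over a set $C$ of $m$ candidates that is either a domain $\mathrm{SC}$ (a single-crossing domain of $1+\binom{m}{2}$ rankings, as described in the context) or a Euclidean domain, and let $T(D)$ be a tree arranging the rankings of $D$ as described in the context. There is an algorithm that, given a ranking $v\in\mathcal{L}(C)$ and the tree $T(D)$, computes $\mathrm{swap}(D,v)$ in time $O(|D|)$.
   Context: $\mathcal{L}(C)$ is the set of all linear orders (rankings, votes) over $C$. The swap distance $\mathrm{swap}(u,v)$ is the number of unordered pairs of candidates whose relative order differs in $u$ and $v$. For a set of rankings $D$, $\mathrm{swap}(D,v)=\min_{u\in D}\mathrm{swap}(u,v)$. SC: a domain $\{v_0,v_1,\dots,v_{\binom{m}{2}}\}$ where $v_0\in\mathcal{L}(C)$ is arbitrary and each $v_{i+1}$ is obtained from $v_i$ by swapping a pair of candidates that are adjacent in $v_i$ and that have not been swapped in preceding steps. Euclidean domain: for a positive integer $d$ (the dimension, treated as a constant) and a function $x\colon C\to\mathbb{R}^d$ assigning distinct points to the candidates, $D(x)$ is the set of all rankings $w\in\mathcal{L}(C)$ for which there is a point $x_w\in\mathbb{R}^d$ such that whenever $w$ ranks $a$ ahead of $b$, the Euclidean distance between $x_w$ and $x(a)$ is strictly smaller than that between $x_w$ and $x(b)$. $T(D)$ is a tree (a path in the case of SC) whose vertex set is $D$ and in which every two neighboring rankings are at swap distance exactly $1$; each edge is stored together with the unique pair of candidates on whose order its two endpoint rankings disagree (and the order of this pair in each endpoint). *)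

(* Defs.v *)
From mathcomp Require Import all_boot all_order all_fingroup all_algebra.
From mathcomp Require Import reals.

Set Implicit Arguments.
Unset Strict Implicit.
Unset Printing Implicit Defensive.

Import GRing.Theory Num.Theory.

(* The candidates are 'I_m, and a ranking is the permutation that
   maps a candidate to its position, 0 being the most preferred one. *)

Definition ahead m (v : 'S_m) (a b : 'I_m) : bool := v a < v b.

(* An unordered pair of candidates is counted once, smaller index first. *)
Definition swap m (u v : 'S_m) : nat :=
  #|[set p : 'I_m * 'I_m |
      (p.1 < p.2) && (ahead u p.1 p.2 != ahead v p.1 p.2)]|.

(* 'C(m, 2) bounds every swap distance, so for a nonempty D this is the
   minimum of [swap u v] over u in D. *)
Definition swap_dom m (D : {set 'S_m}) (v : 'S_m) : nat :=
  \big[minn/'C(m, 2)]_(u in D) swap u v.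

(* [w] arises from [u] by swapping the pair [p], which is adjacent in [u];
   [tperm a b * u] is the map sending [c] to [u (tperm a b c)]. *)
Definition adjacent_swap m (p : {set 'I_m}) (u w : 'S_m) : Prop :=
  exists a b : 'I_m,
    [/\ p = [set a; b], u b = (u a).+1 :> nat & w = (tperm a b * u)%g].

Definition is_SC m (D : {set 'S_m}) : Prop :=
  exists (s : nat -> 'S_m) (p : nat -> {set 'I_m}),
    [/\ forall i, i < 'C(m, 2) -> adjacent_swap (p i) (s i) (s i.+1),
        forall i j, i < j < 'C(m, 2) -> p i != p j
      & D = [set s (val i) | i : 'I_('C(m, 2).+1)]].

(* The library's norm on row vectors is the maximum norm,
   hence an explicit distance. *)

Definition edist (R : realType) d (y z : 'rV[R]_d) : R :=
  Num.sqrt (\sum_(i < d) (y 0%R i - z 0%R i) ^+ 2)%R.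

Definition is_Euclidean (R : realType) d m (D : {set 'S_m}) : Prop :=
  exists x : 'I_m -> 'rV[R]_d, injective x /\
    forall w : 'S_m, w \in D <->
      exists y : 'rV[R]_d, forall a b : 'I_m,
        ahead w a b -> (edist y (x a) < edist y (x b))%R.

Definition is_tree (V : finType) (D : {set V}) (T : rel V) : Prop :=
  [/\ symmetric T,
      irreflexive T,
      forall u w, T u w -> (u \in D) && (w \in D),
      {in D &, forall u w, connect T u w}
    & forall c : seq V, 2 < size c -> ~ ucycle T c].

Definition is_path (V : finType) (D : {set V}) (T : rel V) : Prop :=
  exists s : seq V,
    [/\ uniq s, s =i D
      & forall u w, T u w = infix [:: u; w] s || infix [:: w; u] s].

Definition is_swap_tree m (D : {set 'S_m}) (T : rel 'S_m) : Prop :=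
  is_tree D T /\ forall u w, T u w -> swap u w = 1.

(* The tree as a data structure: the rankings in some order and, for each of
   them, its adjacency list.  An entry (j, (a, b)) in the list of the i-th
   ranking is an edge to the j-th ranking; the i-th ranking has a ahead of b
   and the j-th one has b ahead of a. *)
Record tree_data m := TreeData {
  verts : seq 'S_m;
  arcs : seq (seq (nat * ('I_m * 'I_m)))
}.

Definition stores m (X : tree_data m) (D : {set 'S_m}) (T : rel 'S_m) : Prop :=
  [/\ uniq (verts X),
      verts X =i D,
      size (arcs X) = size (verts X)
    & forall i, i < size (verts X) ->
        let u := nth 1%g (verts X) i in
        let L := nth [::] (arcs X) i in
        perm_eq [seq nth 1%g (verts X) x.1 | x <- L] (enum [pred w | T u w])
        /\ forall j a b, (j, (a, b)) \in L ->
             [/\ j < size (verts X), ahead u a b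
               & ahead (nth 1%g (verts X) j) b a]].

(* A uniform-cost RAM programmed with while loops.  A program
   mentions a fixed finite number of scalar variables and of arrays (which
   could be interleaved into one memory).  The only arithmetic operations are
   addition and truncated subtraction. *)

Record state := State {
  scal : nat -> nat;
  arr : nat -> nat -> nat
}.

Inductive expr :=
| Const (n : nat)
| Var (x : nat)
| Read (a : nat) (e : expr)
| Plus (e1 e2 : expr)
| Minus (e1 e2 : expr).

Inductive cmd :=
| Skip
| Assign (x : nat) (e : expr)
| Write (a : nat) (e1 e2 : expr)
| Then (P Q : cmd)
| IfLt (e1 e2 : expr) (P Q : cmd)
| WhileLt (e1 e2 : expr) (P : cmd).

Fixpoint eval (s : state) (e : expr) : nat :=
  match e with
  | Const n => n
  | Var x => scal s x
  | Read a e => arr s a (eval s e)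
  | Plus e1 e2 => eval s e1 + eval s e2
  | Minus e1 e2 => eval s e1 - eval s e2
  end.

Fixpoint cost (e : expr) : nat :=
  match e with
  | Const _ | Var _ => 1
  | Read _ e => (cost e).+1
  | Plus e1 e2 | Minus e1 e2 => (cost e1 + cost e2).+1
  end.

Definition upd A (f : nat -> A) (i : nat) (y : A) : nat -> A :=
  fun j => if j == i then y else f j.

Definition set_scal (s : state) (x n : nat) : state :=
  State (upd (scal s) x n) (arr s).

Definition set_arr (s : state) (a i n : nat) : state :=
  State (scal s) (upd (arr s) a (upd (arr s a) i n)).

(* [exec W P s s' t]: started in [s], the program [P] halts in [s'] after [t]
   elementary steps, never storing a number above [W] nor writing at an index
   above [W].  [W] bounds the machine words: otherwise unit-cost additions
   could build up very long integers. *)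
Inductive exec (W : nat) : cmd -> state -> state -> nat -> Prop :=
| ExecSkip s :
    exec W Skip s s 1
| ExecAssign x e s :
    eval s e <= W ->
    exec W (Assign x e) s (set_scal s x (eval s e)) (cost e).+1
| ExecWrite a e1 e2 s :
    eval s e1 <= W -> eval s e2 <= W ->
    exec W (Write a e1 e2) s (set_arr s a (eval s e1) (eval s e2))
      (cost e1 + cost e2).+1
| ExecThen P Q s1 s2 s3 t1 t2 :
    exec W P s1 s2 t1 -> exec W Q s2 s3 t2 ->
    exec W (Then P Q) s1 s3 (t1 + t2)
| ExecIfTrue e1 e2 P Q s s' t :
    eval s e1 < eval s e2 -> exec W P s s' t ->
    exec W (IfLt e1 e2 P Q) s s' (cost e1 + cost e2 + t).+1
| ExecIfFalse e1 e2 P Q s s' t :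
    eval s e2 <= eval s e1 -> exec W Q s s' t ->
    exec W (IfLt e1 e2 P Q) s s' (cost e1 + cost e2 + t).+1
| ExecWhileTrue e1 e2 P s1 s2 s3 t1 t2 :
    eval s1 e1 < eval s1 e2 ->
    exec W P s1 s2 t1 -> exec W (WhileLt e1 e2 P) s2 s3 t2 ->
    exec W (WhileLt e1 e2 P) s1 s3 (cost e1 + cost e2 + t1 + t2).+1
| ExecWhileFalse e1 e2 P s :
    eval s e2 <= eval s e1 ->
    exec W (WhileLt e1 e2 P) s s (cost e1 + cost e2).+1.

(* Input: array 0 holds m and the number of rankings in the tree, array 1 the
   ranking v, array 2 the rankings of the tree one after the other; every
   ranking is listed from its most to its least preferred candidate.  Arrays
   4, 5, 6 hold the concatenated adjacency lists, component by component, and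
   array 3 the position where each list starts, followed by the total length.
   All other cells and all scalar variables are 0. *)

Definition listing m (v : 'S_m) : seq nat :=
  [seq val (v^-1 i)%g | i <- enum 'I_m].

Definition offsets (ns : seq nat) : seq nat :=
  [seq sumn (take i ns) | i <- iota 0 (size ns).+1].

Definition input m (v : 'S_m) (X : tree_data m) : state :=
  let L := flatten (arcs X) in
  State (fun=> 0) (fun a => nth 0 (nth [::]
    [:: [:: m; size (verts X)];
        listing v;
        flatten [seq listing u | u <- verts X];
        offsets (shape (arcs X));
        [seq x.1 | x <- L];
        [seq val x.2.1 | x <- L];
        [seq val x.2.2 | x <- L]] a)).

Definition output (s : state) : nat := scal s 0.

(* Main.v *)
Require Import Defs.
From mathcomp Require Import all_boot all_order all_fingroup all_algebra.
From mathcomp Require Import reals.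
From mathcomp Require Import zify ring lra.

(* Every pair of candidates occurs in both orders in D: in the single-crossing
   case all 'C(m, 2) pairs get swapped, and in the Euclidean case the moment
   curve starting at x(a) leaves all bisectors at once, so that a voter on it
   close to x(a) has a strict ranking with a in front.  As D is connected
   through single swaps, each ordered pair is the label of an arc of the tree,
   and different pairs label different arcs.  A forest on D has at most 2|D|
   arcs, so m (m - 1) <= 2|D|.  Hence there is time to compare v with one
   ranking naively; along an edge of the tree the distance to v then changes by
   1, up or down according to the order in v of the swapped pair, so that a
   breadth-first search finds all the other distances in time O(|D|). *)

Set Implicit Arguments.
Unset Strict Implicit.
Unset Printing Implicit Defensive.

(** * Forests and swap distances *)

(** The first vertex of a longest simple [T]-path inside [A] will do: by maximality its neighbours
    in [A] lie on the path, and one other than the second vertex would close a cycle. *)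
Lemma acyclic_leaf (V : finType) (T : rel V) (A : {set V}) :
  symmetric T -> irreflexive T ->
  (forall c : seq V, 2 < size c -> ~ ucycle T c) ->
  A != set0 -> exists2 x, x \in A & #|[set w in A | T x w]| <= 1.
Proof.
move=> symT irrT acT /set0Pn[x0 Ax0].
pose good (s : seq V) := [&& uniq s, sorted T s & all (mem A) s].
pose P n := [exists t : n.-tuple V, good t].
have exP : exists n, P n.
  by exists 1; apply/existsP; exists [tuple x0]; rewrite /good /= Ax0.
have maxP n : P n -> n <= #|V|.
  by case/existsP=> t /and3P[/card_uniqP ut _ _]; rewrite -(size_tuple t) -ut max_card.
case: (ex_maxnP exP maxP) => n /existsP[t goodt] maxn.
have {}maxn s : good s -> size s <= n.
  by move=> gs; apply: maxn; apply/existsP; exists (in_tuple s).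
have := size_tuple t; case: (val t) goodt => [|x p] goodt szt.
  have: size [:: x0] <= n by apply: maxn; rewrite /good /= Ax0.
  by rewrite -szt.
case/and3P: goodt => uxp pxp /= /andP[Ax Ap].
exists x => //; rewrite leqNgt; apply/negP=> deg2.
have nbr w : w \in A -> T x w -> w \in p.
  move=> Aw Txw; apply/negPn/negP=> pw.
  have: good [:: w, x & p].
    apply/and3P; split; rewrite /= ?Aw ?Ax ?Ap // 1?symT ?Txw //.
    move: uxp => /= ->; rewrite inE negb_or pw !andbT.
    by apply: contraTneq Txw => ->; rewrite irrT.
  by move/maxn; rewrite -szt /= ltnn.
case: p nbr uxp pxp Ap {maxn szt} => [|y p] nbr uxp pxp Ap.
  case/card_gt1P: deg2 => w [z [+ _ _]].
  by rewrite inE => /andP[Aw Tw]; move: (nbr _ Aw Tw).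
have [w /andP[Aw Txw] yw] : exists2 w, (w \in A) && T x w & w != y.
  case/card_gt1P: deg2 => w [z []]; rewrite !inE => Hw Hz wz.
  have [wy | wy] := eqVneq w y; last by exists w.
  by exists z => //; rewrite eq_sym -wy.
have := nbr _ Aw Txw; rewrite inE (negbTE yw) /= => pw.
case/splitPr: pw uxp pxp {nbr Ap} => p1 p2 uxp pxp.
apply: (acT (x :: y :: rcons p1 w)); first by rewrite /= size_rcons.
move: uxp pxp; rewrite -cat_rcons -!cat_cons cat_uniq /= cat_path.
move=> /andP[u1 _] /and3P[Txy pth _]; apply/andP; split=> //.
by rewrite /= Txy rcons_path last_rcons pth symT.
Qed.

(** Induction on [#|A|], removing a leaf: its own degree is at most 1, and by symmetry the other
    degrees drop by at most 1 in total. *)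
Lemma acyclic_degree_sum (V : finType) (T : rel V) (A : {set V}) :
  symmetric T -> irreflexive T ->
  (forall c : seq V, 2 < size c -> ~ ucycle T c) ->
  \sum_(u in A) #|[set w in A | T u w]| <= #|A|.*2.
Proof.
move=> symT irrT acT; have [k] := ubnP #|A|.
elim: k A => // k IH A ltAk; have [->|A0] := eqVneq A set0.
  by rewrite big_set0.
have [x Ax degx] := acyclic_leaf symT irrT acT A0.
rewrite (big_setD1 x) //= (cardsD1 x A) Ax add1n doubleS.
have split_deg u : u \in A :\ x ->
    #|[set w in A | T u w]| = #|[set w in A :\ x | T u w]| + T u x.
  move=> _; rewrite (cardsD1 x) addnC inE Ax /=; congr (_ + _).
  by apply: eq_card => w; rewrite !inE andbA.
rewrite (eq_bigr _ split_deg) big_split /=.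
have leaf_in : \sum_(u in A :\ x) T u x <= 1.
  apply: leq_trans degx; rewrite -sum1_card [leqRHS]big_mkcond /=.
  rewrite big_mkcond /=; apply: leq_sum => u _; rewrite !inE symT.
  by case: (u == x); case: (u \in A); case: (T x u).
rewrite (cardsD1 x) Ax in ltAk; have := IH (A :\ x).
move/(_ ltAk); lia.
Qed.

(** * Discordant pairs and swap distances *)

Lemma ahead_asym m (u : 'S_m) a b : a != b -> ahead u b a = ~~ ahead u a b.
Proof.
move=> ab; rewrite /ahead -leqNgt ltn_neqAle andb_idl //= => _.
by apply: contra_neq ab => /val_inj/perm_inj.
Qed.

Definition discord m (u v : 'S_m) : {set 'I_m * 'I_m} :=
  [set p : 'I_m * 'I_m | (p.1 < p.2) && (ahead u p.1 p.2 != ahead v p.1 p.2)].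

Definition ordered m (a b : 'I_m) := if a < b then (a, b) else (b, a).

Lemma ordered_discord m (u w : 'S_m) a b :
  a != b -> (ordered a b \in discord u w) = (ahead u a b != ahead w a b).
Proof.
move=> ab; rewrite inE /ordered; case: (ltngtP a b) ab => [lt|lt|/val_inj->].
- by rewrite /= lt.
- move=> ab; rewrite /= lt !(ahead_asym _ ab).
  by case: ahead; case: ahead.
by rewrite eqxx.
Qed.

Lemma ahead_neq m (u : 'S_m) a b : ahead u a b -> a != b.
Proof. by apply: contraTneq => ->; rewrite /ahead ltnn. Qed.

Lemma swap1_discord m (u w : 'S_m) a b :
  swap u w = 1 -> ahead u a b -> ahead w b a ->
  discord u w = [set ordered a b].
Proof.
move=> /eqP/cards1P[q def_q] uab wba; have ab := ahead_neq uab.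
rewrite /discord def_q; apply/eqP.
have := ordered_discord u w ab.
by rewrite /discord def_q inE uab -(negbK (ahead w a b)) -ahead_asym // wba => /eqP->.
Qed.

(** Apart from the pair labelling the edge, [u] and [w] disagree with [v] on the same pairs; on that
    pair exactly one of them disagrees with [v]. *)
Lemma swap_step m (u w v : 'S_m) a b :
  swap u w = 1 -> ahead u a b -> ahead w b a ->
  if ahead v a b then swap w v = (swap u v).+1
  else swap u v = (swap w v).+1.
Proof.
move=> uw uab wba; have ab := ahead_neq uab.
have def_uw := swap1_discord uw uab wba.
have rest : discord u v :\ ordered a b = discord w v :\ ordered a b.
  apply/setP=> q; rewrite 2!in_setD1; have [//|qab] := eqVneq q.
  have : q \notin discord u w by rewrite def_uw inE.
  by rewrite !inE; do 3 case: (ahead _ _ _); rewrite ?andbF ?andbT //= => /negbTE.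
rewrite -[swap u v]/#|discord u v| -[swap w v]/#|discord w v|.
rewrite (cardsD1 (ordered a b) (discord u v)) (cardsD1 (ordered a b) (discord w v)) -rest !ordered_discord // uab.
have -> : ahead w a b = false by rewrite -(negbK (ahead w a b)) -ahead_asym // wba.
by case: ahead.
Qed.

Lemma card_ltn_pairs m : #|[set p : 'I_m * 'I_m | p.1 < p.2]| = 'C(m, 2).
Proof.
rewrite -sum1_card big_mkcond /= -bin2_sum big_mkord.
transitivity (\sum_(b < m) \sum_(a < m) if a < b then 1 else 0).
  by rewrite exchange_big pair_bigA; apply: eq_bigr => p _; rewrite inE.
apply: eq_bigr => b _; rewrite -big_mkcond /=.
rewrite (big_ord_narrow (ltnW (ltn_ord b))).
by rewrite sum_nat_const card_ord muln1.
Qed.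

Lemma swap_le_bin m (u v : 'S_m) : swap u v <= 'C(m, 2).
Proof.
rewrite -card_ltn_pairs; apply: subset_leq_card.
by apply/subsetP=> p; rewrite !inE => /andP[].
Qed.

(** The default value of the iterated minimum does no harm, since [swap_le_bin] bounds the attained
    value by it. *)
Lemma swap_domP m (D : {set 'S_m}) (v : 'S_m) k :
  (exists2 u, u \in D & k = swap u v) -> (forall u, u \in D -> k <= swap u v) ->
  k = swap_dom D v.
Proof.
case=> u Du -> minu; apply/eqP; rewrite eqn_leq; apply/andP; split.
  rewrite /swap_dom; elim/big_ind: _ => [|x y ux uy|w /minu //].
    exact: swap_le_bin.
  by rewrite leq_min ux.
rewrite /swap_dom -big_filter.
have : u \in [seq w <- index_enum _ | w \in D] by rewrite mem_filter Du mem_index_enum.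
elim: [seq _ <- _ | _] => // w l IH; rewrite inE big_cons geq_min.
by case/predU1P=> [->|/IH->]; rewrite ?leqnn ?orbT.
Qed.

(** This serves twice: to find an edge along which two candidates change order, and to show that the
    search reaches every ranking. *)
Lemma connect_cut (V : finType) (T : rel V) (P : pred V) u w :
  connect T u w -> P u -> ~~ P w -> exists x y, [/\ T x y, P x & ~~ P y].
Proof.
case/connectP=> p; elim: p u => [|y p IH] u /= => [_ -> Pu|].
  by rewrite Pu.
case/andP=> Tuy py lw Pu; have [Py|Py] := boolP (P y).
  exact: IH py lw Py.
by move=> _; exists u, y.
Qed.

(** Each ordered pair [(a, b)] is sent to an arc along which [a] loses its lead over [b]. This is
    injective: being a single swap, the arc determines the unordered pair, and its direction
    determines the order. *)
Lemma swap_tree_card m (D : {set 'S_m}) (T : rel 'S_m) :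
  is_swap_tree D T ->
  (forall a b, a != b -> exists2 u, u \in D & ahead u a b) ->
  m * m.-1 <= #|[set e : 'S_m * 'S_m | T e.1 e.2]|.
Proof.
move=> [[symT irrT TD conT _] T1] both.
have arcP (p : 'I_m * 'I_m) : exists e : 'S_m * 'S_m, (p.1 != p.2) ==>
    [&& T e.1 e.2, ahead e.1 p.1 p.2 & ahead e.2 p.2 p.1].
  have [eqp|ab] := eqVneq p.1 p.2; first by exists (1, 1)%g.
  have [u Du uab] := both _ _ ab.
  have ba := ab; rewrite eq_sym in ba.
  have [w Dw wba] := both _ _ ba.
  have nwab : ~~ ahead w p.1 p.2 by rewrite -ahead_asym.
  have [x [y [Txy xab yab]]] :=
    connect_cut (P := fun z => ahead z p.1 p.2) (conT u w Du Dw) uab nwab.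
  by exists (x, y); rewrite Txy xab ahead_asym //= yab.
pose f p := xchoose (arcP p).
have fP p : p.1 != p.2 ->
    [/\ T (f p).1 (f p).2, ahead (f p).1 p.1 p.2 & ahead (f p).2 p.2 p.1].
  by move=> np; apply/and3P; exact: (implyP (xchooseP (arcP p))) np.
have -> : m * m.-1 = #|[set p : 'I_m * 'I_m | p.1 != p.2]|.
  have -> : [set p : 'I_m * 'I_m | p.1 != p.2] = ~: [set (a, a) | a : 'I_m].
    apply/setP=> -[a b]; rewrite !inE /=; congr (~~ _); apply/eqP/imsetP.
      by move=> ->; exists b.
    by case=> c _ [-> ->].
  rewrite cardsCs setCK card_imset; last by move=> a b [].
  by rewrite card_prod card_ord -subn1 mulnBr muln1.
rewrite -(card_in_imset (f := f)).
  apply/subset_leq_card/subsetP=> e /imsetP[p]; rewrite inE => /fP[Tf _ _] ->.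
  by rewrite inE.
move=> [a b] [a' b']; rewrite !inE => /fP[/T1 s1 h1 h2] /fP[_ h1' h2'] eqf.
rewrite -eqf /= in h1' h2'; move: (swap1_discord s1 h1 h2).
rewrite (swap1_discord s1 h1' h2') /= => /set1_inj.
move: h1 h1'; rewrite /= /ordered.
(* In the two mixed cases the pairs are reverses of each other, and one ranking would have [a] ahead
   of [b] and [b] ahead of [a]. *)
case: ifP => _; case: ifP => _ h1 h1' [e1 e2]; rewrite ?e1 ?e2 //.
- by move: h1 h1'; rewrite -e1 -e2 /ahead; lia.
- by move: h1 h1'; rewrite -e1 -e2 /ahead; lia.
Qed.

(** The ['C(m, 2)] swapped pairs are distinct two-element sets, so they exhaust these. When [a] and
    [b] are swapped, [a] is ahead either just before or just after. *)
Lemma SC_both_orders m (D : {set 'S_m}) a b :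
  is_SC D -> a != b -> exists2 u, u \in D & ahead u a b.
Proof.
case=> s [p [adj injp ->]] ab.
pose f (i : 'I_('C(m, 2))) := p i.
have injf : injective f.
  move=> i j eqf; apply/val_inj; case: (ltngtP i j) => // lt.
  - by have := injp i j; rewrite lt ltn_ord /f in eqf *; rewrite eqf eqxx => /(_ isT).
  - by have := injp j i; rewrite lt ltn_ord /f in eqf *; rewrite eqf eqxx => /(_ isT).
have imf : f @: setT = [set A : {set 'I_m} | #|A| == 2].
  apply/eqP; rewrite eqEcard card_imset // cardsT card_draws !card_ord leqnn andbT.
  apply/subsetP=> _ /imsetP[i _ ->]; rewrite inE /f.
  have [c [e [-> hc _]]] := adj i (ltn_ord i).
  have ce : c != e by apply/eqP=> ce; move: hc; rewrite ce; lia.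
  by rewrite cards2 ce.
have : [set a; b] \in f @: setT by rewrite imf inE cards2 ab.
case/imsetP=> i _; rewrite /f => pi.
have inD j : j <= 'C(m, 2) -> s j \in [set s (val i) | i : 'I_('C(m, 2).+1)].
  by rewrite -ltnS => lt; apply/imsetP; exists (Ordinal lt).
have [c [e [pce hc def_s]]] := adj i (ltn_ord i).
have [ua|ub] := boolP (ahead (s i) a b).
  by exists (s i) => //; apply: inD; apply: ltnW.
exists (s i.+1); first by apply: inD.
have : (c == a) && (e == b) || (c == b) && (e == a).
  have ce : c != e by apply/eqP=> ce; move: hc; rewrite ce; lia.
  move: (set21 c e) (set22 c e) ce; rewrite -pce -pi.
  by case/set2P=> ->; case/set2P=> ->; rewrite ?eqxx ?orbT.
case/orP=> /andP[/eqP ? /eqP ?]; subst c e.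
  by move: ub; rewrite /ahead hc ltnSn.
by rewrite /ahead def_s !permM tpermL tpermR hc.
Qed.

(** * Execution with a time budget *)

(* [k] is a time budget; [Q] receives what is left of it. *)
Definition run W k P s (Q : nat -> state -> Prop) :=
  exists s' t, [/\ exec W P s s' t, t <= k & Q (k - t) s'].

Lemma run_mono W k P s (Q Q' : nat -> state -> Prop) :
  (forall k s, Q k s -> Q' k s) -> run W k P s Q -> run W k P s Q'.
Proof. by move=> sub [s' [t [ex le Qs]]]; exists s', t; split=> //; exact: sub. Qed.

Lemma run_then W k P P' s Q :
  run W k P s (fun k s => run W k P' s Q) -> run W k (Then P P') s Q.
Proof.
move=> [s1 [t1 [ex1 le1 [s2 [t2 [ex2 le2 Qs]]]]]].
exists s2, (t1 + t2); split; [exact: ExecThen ex1 ex2 | lia | ].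
by rewrite subnDA.
Qed.

(** The budget itself is the termination measure, as each test consumes some of it. An invariant
    relating [k] to the loop counters proves halting and the time bound together. *)
Lemma run_while W (I Q : nat -> state -> Prop) k s e1 e2 P :
  I k s ->
  (forall k s, I k s -> cost e1 + cost e2 < k /\
     if eval s e1 < eval s e2
     then run W (k - (cost e1 + cost e2).+1) P s I
     else Q (k - (cost e1 + cost e2).+1) s) ->
  run W k (WhileLt e1 e2 P) s Q.
Proof.
move=> + step; have [N] := ubnP k; elim: N => // N IH in k s * => ltkN Is.
have [lt] := step k s Is; case: ifP => [guard|/negbT guard Qs].
  move=> [s1 [t1 [ex1 le1 Is1]]].
  have [|s2 [t2 [ex2 le2 Qs]]] := IH _ _ _ Is1; first by lia.
  exists s2, (cost e1 + cost e2 + t1 + t2).+1; split; [|lia|].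
    exact: ExecWhileTrue ex1 ex2.
  by move: Qs; congr (Q _ _); lia.
exists s, (cost e1 + cost e2).+1; split=> //.
by apply: ExecWhileFalse; rewrite leqNgt.
Qed.

(** Weakest precondition by symbolic execution, with costs and word bounds. Loops are left as [run]
    goals, to be met by [run_while] with an invariant. *)
Fixpoint wp W (P : cmd) k s (Q : nat -> state -> Prop) : Prop :=
  match P with
  | Skip => 0 < k /\ Q (k - 1) s
  | Assign x e =>
      [/\ eval s e <= W, cost e < k
        & Q (k - (cost e).+1) (set_scal s x (eval s e))]
  | Write a e1 e2 =>
      [/\ eval s e1 <= W, eval s e2 <= W, cost e1 + cost e2 < k
        & Q (k - (cost e1 + cost e2).+1)
            (set_arr s a (eval s e1) (eval s e2))]
  | Then P1 P2 => wp W P1 k s (fun k s => wp W P2 k s Q)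
  | IfLt e1 e2 P1 P2 =>
      cost e1 + cost e2 < k /\
      if eval s e1 < eval s e2 then wp W P1 (k - (cost e1 + cost e2).+1) s Q
      else wp W P2 (k - (cost e1 + cost e2).+1) s Q
  | WhileLt _ _ _ => run W k P s Q
  end.

Lemma wpP W P k s Q : wp W P k s Q -> run W k P s Q.
Proof.
elim: P k s Q => [|x e|a e1 e2|P IHP P' IHP'|e1 e2 P IHP P' IHP'|e1 e2 P _] k s Q //=.
- by case=> lt Qs; exists s, 1; split=> //; exact: ExecSkip.
- case=> le lt Qs; exists (set_scal s x (eval s e)), (cost e).+1.
  by split=> //; exact: ExecAssign.
- case=> le1 le2 lt Qs.
  exists (set_arr s a (eval s e1) (eval s e2)), (cost e1 + cost e2).+1.
  by split=> //; exact: ExecWrite.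
- move=> h; apply: run_then; move: (IHP _ _ _ h); apply: run_mono => k' s'.
  exact: IHP'.
case=> lt; case: ifP => [g|/negbT g].
  move/IHP => [s' [t [ex le Qs]]]; exists s', (cost e1 + cost e2 + t).+1.
  split; [exact: ExecIfTrue|lia|by move: Qs; congr (Q _ _); lia].
move/IHP' => [s' [t [ex le Qs]]]; exists s', (cost e1 + cost e2 + t).+1.
split; [by apply: ExecIfFalse; rewrite // leqNgt|lia|].
by move: Qs; congr (Q _ _); lia.
Qed.

(** * The program *)

(* Variables 1, 2, 3 and 10 are loop counters and 4 is the distance from the
   first ranking to v; 5 and 6 are the ends of the queue, 7 is the ranking being
   processed, 8 the current arc and 9 its target.  Arrays 7 and 8 hold the
   positions of the candidates in v and in the first ranking. *)
Definition positions_loop : cmd :=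
  WhileLt (Var 1) (Read 0 (Const 0))
    (Then (Write 7 (Read 1 (Var 1)) (Var 1))
    (Then (Write 8 (Read 2 (Var 1)) (Var 1))
          (Assign 1 (Plus (Var 1) (Const 1))))).

(** The loop inverts both listings; its invariant is that the entries of candidates at positions
    below the counter are right. In the budget, 20 covers one iteration and 10 the final test. *)
Lemma positions_run W k s m (u v : 'S_m) Q :
  arr s 0 0 = m ->
  (forall i : 'I_m, arr s 1 i = val (v^-1 i)%g) ->
  (forall i : 'I_m, arr s 2 i = val (u^-1 i)%g) ->
  scal s 1 = 0 -> m <= W -> 20 * m + 10 <= k ->
  (forall k' s', k <= k' + (20 * m + 10) ->
     (forall a, (a < 7) || (8 < a) -> arr s' a = arr s a) ->
     (forall x, x != 1 -> scal s' x = scal s x) ->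
     (forall c : 'I_m, arr s' 7 c = v c) ->
     (forall c : 'I_m, arr s' 8 c = u c) -> Q k' s') ->
  run W k positions_loop s Q.
Proof.
move=> s00 s1 s2 sc1 mW lek post.
pose I k' s' := [/\ scal s' 1 <= m, k <= k' + 20 * scal s' 1,
  (forall a, (a < 7) || (8 < a) -> arr s' a = arr s a) /\
  (forall x, x != 1 -> scal s' x = scal s x),
  (forall c : 'I_m, v c < scal s' 1 -> arr s' 7 c = v c) &
  (forall c : 'I_m, u c < scal s' 1 -> arr s' 8 c = u c)].
apply: (run_while (I := I)); first by rewrite /I sc1; split=> //; lia.
move=> k' s' [im lek' [fra frs] pv pu] /=; split; first by lia.
rewrite fra // s00. case: ifP => [lt|/negbT]; last first.
  rewrite -leqNgt => mi; apply: post => //; first by lia.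
  - by move=> c; apply: pv; apply: leq_trans mi.
  - by move=> c; apply: pu; apply: leq_trans mi.
have e1 := s1 (Ordinal lt); have e2 := s2 (Ordinal lt); rewrite /= in e1 e2.
have ltp (w : 'S_m) : (w^-1 (Ordinal lt))%g < m by exact: ltn_ord.
have inj_pos (w : 'S_m) (c : 'I_m) :
    w c < scal s' 1 + 1 -> if val c == val (w^-1 (Ordinal lt))%g
      then scal s' 1 = w c else w c < scal s' 1.
  rewrite addn1 ltnS leq_eqVlt val_eqE; have [->|ne] := eqVneq c.
    by rewrite permKV.
  by case/predU1P=> // /esym ev; case/eqP: ne; apply: (can_inj (permK w));
     rewrite permKV; apply: val_inj.
apply: wpP => /=; rewrite /upd /= !fra // e1 e2.
have lv := ltp v; have lu := ltp u.
split; [lia|lia|lia|split; [lia|lia|lia|split; [lia|lia|]]].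
rewrite /I /= /upd /=; split; [lia|lia|split| |].
- by case=> [|[|[|[|[|[|[|[|[|a]]]]]]]]] // ax; rewrite /upd /= fra.
- by case=> [|[|x]] // nx; apply: frs.
- by move=> c /inj_pos; rewrite /upd; case: eqP => [_|_ /pv].
- by move=> c /inj_pos; rewrite /upd; case: eqP => [_|_ /pu].
Qed.

(** * Naive computation of the first distance *)

Definition incr x := Assign x (Plus (Var x) (Const 1)).

Definition swap_row_loop : cmd :=
  WhileLt (Var 3) (Read 0 (Const 0))
    (Then
       (IfLt (Var 2) (Var 3)
          (IfLt (Read 8 (Var 2)) (Read 8 (Var 3))
             (IfLt (Read 7 (Var 2)) (Read 7 (Var 3)) Skip (incr 4))
             (IfLt (Read 7 (Var 2)) (Read 7 (Var 3)) (incr 4) Skip))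
          Skip)
       (incr 3)).

Definition swap_loop : cmd :=
  WhileLt (Var 2) (Read 0 (Const 0))
    (Then (Assign 3 (Const 0)) (Then swap_row_loop (incr 2))).

(** Membership in [discord] in terms of position arrays; the test [a < b] makes a sum over all index
    pairs count each unordered pair once. *)
Definition discordant (f g : nat -> nat) a b :=
  (a < b) && ((f a < f b) != (g a < g b)).

Lemma swap_row_run W k s m Q :
  arr s 0 0 = m -> scal s 2 < m -> scal s 3 = 0 -> scal s 4 + m <= W ->
  40 * m + 10 <= k ->
  (forall k' s', k <= k' + (40 * m + 10) -> arr s' = arr s ->
     (forall x, x \notin [:: 3; 4] -> scal s' x = scal s x) ->
     scal s' 4 = scal s 4 +
       \sum_(0 <= b < m) discordant (arr s 8) (arr s 7) (scal s 2) b -> Q k' s') ->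
  run W k swap_row_loop s Q.
Proof.
move=> s00 am b0 lW lek post.
pose I k' s' := [/\ scal s' 3 <= m, k <= k' + 40 * scal s' 3,
  arr s' = arr s, (forall x, x \notin [:: 3; 4] -> scal s' x = scal s x) &
  scal s' 4 = scal s 4 +
    \sum_(0 <= b < scal s' 3) discordant (arr s 8) (arr s 7) (scal s 2) b].
apply: (run_while (I := I)).
  by rewrite /I b0 big_geq //; split=> //; lia.
move=> k' s' [bm lek' eqa eqs cnt] /=; split; first by lia.
have sum_le : \sum_(0 <= b < scal s' 3) discordant (arr s 8) (arr s 7) (scal s 2) b
    <= scal s' 3.
  rewrite -[leqRHS]subn0 -[leqRHS]muln1 -sum_nat_const_nat.
  by apply: leq_sum => i _; case: discordant.
have s2 := eqs 2 isT.
rewrite eqa s00; case: ifP => [lt|/negbT]; last first.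
  rewrite -leqNgt => mb; apply: post => //; first by lia.
  by rewrite cnt; congr (_ + \sum_(0 <= b < _) _); apply/eqP; rewrite eqn_leq bm.
(* All five branches of the loop body end by advancing variable 3 and differ only in whether
   variable 4 grew; this restores the invariant for each of them. *)
have step k'' t : k'' + 40 >= k' -> arr t = arr s ->
    scal t 3 = (scal s' 3).+1 ->
    scal t 4 = scal s' 4 + discordant (arr s 8) (arr s 7) (scal s 2) (scal s' 3) ->
    (forall x, x \notin [:: 3; 4] -> scal t x = scal s' x) -> I k'' t.
  move=> lek'' at_ t3 t4 tx; rewrite /I t3 t4; split=> //; first by lia.
    by move=> x nx; rewrite tx // eqs.
  by rewrite big_nat_recr //= cnt addnA.
apply: wpP => /=; rewrite /upd /= !eqa s2.
split; first by lia.
case: ifP => ab; last first.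
  split; first by lia.
  split; [by lia|by lia|].
  apply: step => //=; [by lia|by rewrite /upd /= addn1|by rewrite /discordant ab addn0|].
  by case=> [|[|[|[|[|x]]]]].
split; first by lia.
case: ifP => pu; (split; first by lia); case: ifP => pv.
- split; first by lia.
  split; [by lia|by lia|].
  apply: step => //=; [by lia|by rewrite /upd /= addn1|by rewrite /discordant ab pu pv addn0|].
  by case=> [|[|[|[|[|x]]]]].
- split; [by lia|by lia|].
  split; [by lia|by lia|].
  apply: step => //=; [by lia|by rewrite /upd /= addn1|by rewrite /discordant ab pu pv|].
  by case=> [|[|[|[|[|x]]]]].
- split; [by lia|by lia|].
  split; [by lia|by lia|].
  apply: step => //=; [by lia|by rewrite /upd /= addn1|by rewrite /discordant ab pu pv|].
  by case=> [|[|[|[|[|x]]]]].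
split; first by lia.
split; [by lia|by lia|].
apply: step => //=; [by lia|by rewrite /upd /= addn1|by rewrite /discordant ab pu pv addn0|].
by case=> [|[|[|[|[|x]]]]].
Qed.

Lemma swap_run W k s m (u v : 'S_m) Q :
  arr s 0 0 = m -> scal s 2 = 0 -> scal s 4 = 0 ->
  (forall c : 'I_m, arr s 7 c = v c) ->
  (forall c : 'I_m, arr s 8 c = u c) ->
  m * m + m <= W -> (40 * m + 30) * m + 10 <= k ->
  (forall k' s', k <= k' + ((40 * m + 30) * m + 10) -> arr s' = arr s ->
     (forall x, x \notin [:: 2; 3; 4] -> scal s' x = scal s x) ->
     scal s' 4 = swap u v -> Q k' s') ->
  run W k swap_loop s Q.
Proof.
move=> s00 a0 c0 pv pu lW lek post.
pose row a := \sum_(0 <= b < m) discordant (arr s 8) (arr s 7) a b.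
have row_le a : row a <= m.
  rewrite -[leqRHS]subn0 -[leqRHS]muln1 -sum_nat_const_nat.
  by apply: leq_sum => i _; case: discordant.
have swapE : \sum_(0 <= a < m) row a = swap u v.
  rewrite /swap -sum1_card [RHS]big_mkcond big_mkord /row /=.
  under eq_bigr do rewrite big_mkord.
  rewrite pair_bigA; apply: eq_bigr => -[a b] _.
  by rewrite inE /discordant /ahead /= !pu !pv; case: (_ && _).
pose I k' s' := [/\ scal s' 2 <= m, k <= k' + (40 * m + 30) * scal s' 2,
  arr s' = arr s, (forall x, x \notin [:: 2; 3; 4] -> scal s' x = scal s x) &
  scal s' 4 = \sum_(0 <= a < scal s' 2) row a].
apply: (run_while (I := I)).
  by rewrite /I a0 c0 big_geq //; split=> //; lia.
move=> k' s' [am lek' eqa eqs cnt] /=.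
have am_le : m * scal s' 2 <= m * m by rewrite leq_mul2l am orbT.
split; first by nia.
rewrite eqa s00; case: ifP => [lt|/negbT]; last first.
  rewrite -leqNgt => ma; have ea : scal s' 2 = m by lia.
  apply: post => //; first by rewrite ea in lek'; lia.
  by rewrite cnt ea.
have {}am_le : m * (scal s' 2).+1 <= m * m by rewrite leq_mul2l lt orbT.
(* Each row adds at most [m], so the counter stays within the word bound during the next row. *)
have cnt_le : scal s' 4 <= m * scal s' 2.
  rewrite cnt -[scal s' 2 in leqRHS]subn0 mulnC -sum_nat_const_nat.
  exact: leq_sum.
apply: wpP => /=; split; [by lia|by nia|].
apply: (swap_row_run (m := m)) => //=.
- by rewrite eqa.
- by rewrite /upd /=; nia.
- by nia.
move=> k'' s'' lek'' eqa'' eqs'' cnt''.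
have s2 : scal s'' 2 = scal s' 2 by rewrite eqs''.
rewrite s2; split; [by lia|by nia|rewrite /I /= /upd /= addn1; split=> //].
- by nia.
- by rewrite eqa''.
- by case=> [|[|[|[|[|x]]]]] // nx; rewrite /= eqs'' //= -eqs.
- by rewrite big_nat_recr //= cnt'' /= -cnt /upd /= eqa.
Qed.

(** * Breadth-first search *)

Definition scan_loop : cmd :=
  WhileLt (Var 8) (Read 3 (Plus (Var 7) (Const 1)))
    (Then (Assign 9 (Read 4 (Var 8)))
    (Then
       (IfLt (Read 9 (Var 9)) (Const 1)
          (Then (Write 10 (Var 6) (Var 9))
          (Then (incr 6)
             (IfLt (Read 7 (Read 5 (Var 8))) (Read 7 (Read 6 (Var 8)))
                (Write 9 (Var 9) (Plus (Read 9 (Var 7)) (Const 1)))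
                (Write 9 (Var 9) (Minus (Read 9 (Var 7)) (Const 1))))))
          Skip)
       (incr 8))).

Definition search_loop : cmd :=
  WhileLt (Var 5) (Var 6)
    (Then (Assign 7 (Read 10 (Var 5)))
    (Then (Assign 8 (Read 3 (Var 7)))
    (Then scan_loop (incr 5)))).

(* Array 10 holds the queue [q]; array 9 holds, shifted by 1, the values [dst]
   of the vertices that have been enqueued. *)
Record queue_inv (s0 : state) n (dst : nat -> nat) (q : seq nat) (s : state) : Prop :=
  QueueInv {
    qi_frame : forall a, a < 9 -> arr s a = arr s0 a;
    qi_scal : forall x, x \notin [:: 5; 6; 7; 8; 9] -> scal s x = scal s0 x;
    qi_tail : scal s 6 = size q;
    qi_uniq : uniq q;
    qi_lt : forall j, j \in q -> j < n;
    qi_queue : forall i, i < size q -> arr s 10 i = nth 0 q i;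
    qi_dist : forall j, j < n -> arr s 9 j = if j \in q then (dst j).+1 else 0
  }.

Lemma queue_inv_set s0 n dst q s x y :
  x \in [:: 5; 7; 8; 9] -> queue_inv s0 n dst q s ->
  queue_inv s0 n dst q (set_scal s x y).
Proof.
move=> xin [qf qs qt qu ql qq qd]; split=> //.
- move=> z nz; rewrite /= /upd; case: eqP => [ez|_]; last exact: qs.
  by move: nz xin; rewrite ez !inE; lia.
- rewrite /= /upd; case: eqP => [ez|_ //].
  by move: xin; rewrite -ez.
Qed.

Lemma queue_inv_size s0 n dst q s : queue_inv s0 n dst q s -> size q <= n.
Proof.
move=> qi; rewrite -(size_iota 0 n); apply: uniq_leq_size (qi_uniq qi) _.
by move=> j /(qi_lt qi); rewrite mem_iota.
Qed.

Lemma queue_inv_push s0 n dst q s w :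
  queue_inv s0 n dst q s -> w < n -> w \notin q ->
  queue_inv s0 n dst (rcons q w)
    (set_arr (set_scal (set_arr s 10 (size q) w) 6 (size q + 1)) 9 w (dst w).+1).
Proof.
move=> qi wn wq; have [qf qs qt qu ql qq qd] := qi; split.
- move=> a lt; rewrite -qf //= /upd.
  by case: eqP => [|_]; [lia | case: eqP => // ?; lia].
- by move=> x nx; rewrite -qs //= /upd; case: eqP nx => // ->.
- by rewrite size_rcons /= /upd /= addn1.
- by rewrite rcons_uniq wq.
- by move=> j; rewrite mem_rcons inE => /predU1P[->|/ql].
- move=> i; rewrite size_rcons ltnS leq_eqVlt nth_rcons /= /upd /=.
  by case: eqP => [->|ni] /= => [_|lt]; rewrite ?ltnn ?eqxx // lt qq.
move=> j lt; rewrite mem_rcons inE /= /upd /=.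
by case: eqP => [->|_] //=; rewrite qd.
Qed.

(** What the search needs of the arrays, without mention of rankings. Connectivity is put as a
    closure principle that applies directly to the set of processed vertices; the strict bound on
    [dst] leaves room for the shift by 1. *)
Record search_graph W (s : state) n (dst : nat -> nat) : Prop := SearchGraph {
  sg_size : n <= W;
  sg_offset : forall i, i < n -> arr s 3 i <= arr s 3 i.+1 <= W;
  sg_target : forall i e, i < n -> arr s 3 i <= e < arr s 3 i.+1 -> arr s 4 e < n;
  sg_step : forall i e, i < n -> arr s 3 i <= e < arr s 3 i.+1 ->
    if arr s 7 (arr s 5 e) < arr s 7 (arr s 6 e)
    then dst (arr s 4 e) = (dst i).+1
    else dst i = (dst (arr s 4 e)).+1;
  sg_value : forall j, j < n -> dst j < W;
  sg_connected : forall S : pred nat, S 0 ->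
    (forall i e, i < n -> S i -> arr s 3 i <= e < arr s 3 i.+1 -> S (arr s 4 e)) ->
    forall j, j < n -> S j
}.

(** [r] collects the vertices enqueued while the arcs of [u] are scanned, each arc being charged 40.
    A zero in array 9 marks a target not yet enqueued. *)
Lemma scan_run W k s s0 n dst q u Q :
  search_graph W s0 n dst -> queue_inv s0 n dst q s -> u \in q ->
  scal s 7 = u -> scal s 8 = arr s0 3 u ->
  40 * (arr s0 3 u.+1 - arr s0 3 u) + 10 <= k ->
  (forall k' s' r, k <= k' + (40 * (arr s0 3 u.+1 - arr s0 3 u) + 10) ->
     queue_inv s0 n dst (q ++ r) s' -> scal s' 5 = scal s 5 ->
     (forall e, arr s0 3 u <= e < arr s0 3 u.+1 -> arr s0 4 e \in q ++ r) ->
     Q k' s') ->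
  run W k scan_loop s Q.
Proof.
move=> G qi uq s7 s8 lek post; have un := qi_lt qi uq.
have /andP[off_le offW] := sg_offset G un.
pose I k' s' := exists r, [/\ queue_inv s0 n dst (q ++ r) s',
  scal s' 5 = scal s 5 /\ scal s' 7 = u,
  arr s0 3 u <= scal s' 8 <= arr s0 3 u.+1,
  forall e, arr s0 3 u <= e < scal s' 8 -> arr s0 4 e \in q ++ r &
  k <= k' + 40 * (scal s' 8 - arr s0 3 u)].
apply: (run_while (I := I)).
  exists nil; rewrite cats0 s8; split=> //; [lia|lia|lia].
move=> k' s' [r [qi' [s5' s7'] /andP[e1 e2] seen lek']] /=; split; first by lia.
rewrite s7' addn1 (qi_frame qi') //; case: ifP => [lt|/negbT]; last first.
  rewrite -leqNgt => le; have e8 : scal s' 8 = arr s0 3 u.+1 by lia.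
  apply: (post _ _ r) => //; first by lia.
  by move=> e; rewrite -e8; exact: seen.
have ie : arr s0 3 u <= scal s' 8 < arr s0 3 u.+1 by rewrite e1.
have wn := sg_target G un ie; have stepw := sg_step G un ie.
set w := arr s0 4 (scal s' 8) in wn stepw.
have uq' : u \in q ++ r by rewrite mem_cat uq.
have du := qi_dist qi' un; rewrite uq' in du.
have dw := qi_dist qi' wn; have dwW := sg_value G wn; have nW := sg_size G.
have duW := sg_value G un.
have qi9 := queue_inv_set w (isT : 9 \in [:: 5; 7; 8; 9]) qi'.
have done_step k'' t r' : k'' + 40 >= k' ->
    queue_inv s0 n dst (q ++ r') t -> {subset q ++ r <= q ++ r'} -> w \in q ++ r' ->
    scal t 5 = scal s' 5 -> scal t 7 = scal s' 7 -> scal t 8 = scal s' 8 ->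
    I k'' (set_scal t 8 (scal s' 8 + 1)).
  move=> lek'' qit sub wq t5 t7 t8; exists r'; split.
  - exact: queue_inv_set.
  - by rewrite /= /upd /= t5 t7.
  - by rewrite /= /upd /=; lia.
  - rewrite /= /upd /= => e /andP[le]; rewrite addn1 ltnS leq_eqVlt.
    case/predU1P=> [->//|lte]; apply: sub; apply: seen; exact/andP.
  - by rewrite /= /upd /=; lia.
have f4 := qi_frame qi' (isT : 4 < 9); have f5 := qi_frame qi' (isT : 5 < 9).
have f6 := qi_frame qi' (isT : 6 < 9); have f7 := qi_frame qi' (isT : 7 < 9).
apply: wpP => /=; rewrite /upd /= f4 f5 f6 f7 -/w ?s7' du.
split; [lia|lia|split; first by lia].
case: ifP => [new|/negbT old]; last first.
  have wq : w \in q ++ r by move: old; rewrite dw; case: ifP.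
  split; first by lia.
  split; [lia|lia|apply: done_step wq _ _ _ => //; lia].
have nwq : w \notin q ++ r by move: new; rewrite dw; case: ifP.
have push := queue_inv_push qi9 wn nwq.
have := queue_inv_size push; rewrite size_rcons => szq.
rewrite (qi_tail qi').
split; [lia|lia|lia|split; [lia|lia|]].
split; first by lia.
rewrite rcons_cat in push.
have fin k'' val : k'' + 40 >= k' -> val = (dst w).+1 ->
    I k'' (set_scal (set_arr (set_scal (set_arr (set_scal s' 9 w) 10
      (size (q ++ r)) w) 6 (size (q ++ r) + 1)) 9 w val) 8 (scal s' 8 + 1)).
  move=> lek'' ->; apply: done_step push _ _ _ _ _ => //.
  - by move=> x; rewrite !mem_cat mem_rcons inE => /orP[|] ->; rewrite ?orbT.
  - by rewrite mem_cat mem_rcons inE eqxx orbT.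
(* The two branches store [dst u + 2] and [dst u], each equal to [dst w + 1] by [sg_step]; thanks to
   the shift the subtraction is not truncated. *)
case: ifP stepw => _ stepw.
  split; [lia|lia|lia|split; [lia|lia|]].
  by apply: fin; lia.
split; [lia|lia|lia|split; [lia|lia|]].
by apply: fin; lia.
Qed.

(** Amortised count: a vertex enters the queue only once, so the charges [c i] add up to at most 30
    per vertex and 40 per arc, the list lengths telescoping. *)
Lemma search_run W k s n dst Q :
  search_graph W s n dst -> 0 < n ->
  scal s 5 = 0 -> scal s 6 = 1 -> arr s 10 0 = 0 ->
  (forall j, j < n -> arr s 9 j = if j == 0 then (dst j).+1 else 0) ->
  arr s 3 0 = 0 ->
  30 * n + 40 * arr s 3 n + 10 <= k ->
  (forall k' s', k <= k' + (30 * n + 40 * arr s 3 n + 10) ->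
     (forall a, a < 9 -> arr s' a = arr s a) ->
     (forall x, x \notin [:: 5; 6; 7; 8; 9] -> scal s' x = scal s x) ->
     (forall j, j < n -> arr s' 9 j = (dst j).+1) -> Q k' s') ->
  run W k search_loop s Q.
Proof.
move=> G n0 h0 t1 q0 d0 off0 lek post.
pose c i := 30 + 40 * (arr s 3 i.+1 - arr s 3 i).
have sum_c p : uniq p -> (forall i, i \in p -> i < n) ->
    \sum_(i <- p) c i <= 30 * n + 40 * arr s 3 n.
  move=> up ltp; apply: (@leq_trans (\sum_(0 <= i < n) c i)).
    apply: (uniq_sub_le_big leqnn (fun x y => leq_addr y x)) => //.
    - exact: iota_uniq.
    - by move=> i /ltp; rewrite mem_index_iota.
  rewrite big_split /= sum_nat_const_nat -big_distrr telescope_sumn_in //=.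
    by rewrite off0; lia.
  by move=> i lt; case/andP: (sg_offset G lt).
(* The queue splits into the processed vertices [p] and the waiting ones [r]; all targets of arcs
   from [p] are enqueued. *)
pose I k' s' := exists p r, [/\ queue_inv s n dst (p ++ r) s',
  scal s' 5 = size p, 0 \in p ++ r,
  forall i e, i \in p -> arr s 3 i <= e < arr s 3 i.+1 -> arr s 4 e \in p ++ r &
  k <= k' + \sum_(i <- p) c i].
apply: (run_while (I := I)).
  exists nil, [:: 0]; rewrite big_nil addn0; split=> //; split=> //.
  - by move=> j; rewrite inE => /eqP->.
  - by case.
  - by move=> j lt; rewrite d0 // inE.
move=> k' s' [p [r [qi s5 inq closed lek']]] /=.
have upr := qi_uniq qi; have ltn_q := qi_lt qi.
have sum_p : \sum_(i <- p) c i <= 30 * n + 40 * arr s 3 n.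
  apply: sum_c; first by move: upr; rewrite cat_uniq => /andP[].
  by move=> i ip; apply: ltn_q; rewrite mem_cat ip.
split; first by lia.
rewrite s5 (qi_tail qi) size_cat; case: r => [|u r] in qi inq closed upr ltn_q *.
  (* Nothing waits: [p] contains 0 and is closed under arcs, hence contains every vertex by
     [sg_connected]. *)
  rewrite addn0 ltnn; rewrite cats0 in qi inq closed ltn_q.
  apply: post; [lia|exact: qi_frame qi|exact: qi_scal qi|].
  move=> j lt; rewrite (qi_dist qi lt).
  suff -> : j \in p by [].
  by apply: (sg_connected G) lt => // i e _; exact: closed.
rewrite /= -ltn_subLR // subnn ltn0Sn.
have uq : u \in p ++ u :: r by rewrite mem_cat inE eqxx orbT.
have un := ltn_q u uq.
have uprc : uniq (rcons p u) by move: upr; rewrite -cat_rcons cat_uniq => /andP[].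
have sum_pu : \sum_(i <- rcons p u) c i <= 30 * n + 40 * arr s 3 n.
  apply: sum_c => // i; rewrite mem_rcons inE => /predU1P[->//|ip].
  by apply: ltn_q; rewrite mem_cat ip.
have cu : c u = 30 + 40 * (arr s 3 u.+1 - arr s 3 u) by [].
rewrite big_rcons /= addnC in sum_pu.
have /andP[off_le offW] := sg_offset G un; have nW := sg_size G.
have q5 : arr s' 10 (size p) = u.
  by rewrite (qi_queue qi) ?size_cat /= ?nth_cat ?ltnn ?subnn //; lia.
have f3 := qi_frame qi (isT : 3 < 9).
have szq := queue_inv_size qi; rewrite size_cat /= in szq.
apply: wpP => /=; rewrite s5 q5 /upd /= f3.
split; [lia|lia|split; [lia|lia|]].
apply: (scan_run (u := u) G (q := p ++ u :: r)) => //=.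
- by apply: queue_inv_set => //; exact: queue_inv_set.
- lia.
move=> k'' s'' r'' lek'' qi'' s5'' seen.
rewrite s5'' /= /upd /= s5; split; [lia|lia|].
exists (rcons p u), (r ++ r''); split.
- by apply: queue_inv_set => //; rewrite cat_rcons -cat_cons catA.
- by rewrite /= /upd /= size_rcons addn1.
- by rewrite cat_rcons -cat_cons catA mem_cat inq.
- move=> i e; rewrite cat_rcons -cat_cons catA mem_rcons inE.
  case/predU1P=> [->|ip] h; first exact: seen.
  by rewrite mem_cat (closed i e).
by rewrite big_rcons /=; lia.
Qed.

Definition min_loop : cmd :=
  WhileLt (Var 10) (Read 0 (Const 1))
    (Then
       (IfLt (Minus (Read 9 (Var 10)) (Const 1)) (Var 0)
          (Assign 0 (Minus (Read 9 (Var 10)) (Const 1)))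
          Skip)
       (incr 10)).

Lemma min_run W k s n dst Q :
  arr s 0 1 = n -> scal s 10 = 0 -> n <= W ->
  (forall j, j < n -> arr s 9 j = (dst j).+1) ->
  (exists2 j, j < n & scal s 0 = dst j) -> scal s 0 <= W ->
  30 * n + 10 <= k ->
  (forall k' s', (exists2 j, j < n & scal s' 0 = dst j) ->
     (forall j, j < n -> scal s' 0 <= dst j) -> Q k' s') ->
  run W k min_loop s Q.
Proof.
move=> s01 i0 nW d9 ex0 sW lek post.
pose I k' s' := [/\ arr s' = arr s, scal s' 10 <= n,
  (exists2 j, j < n & scal s' 0 = dst j) /\ scal s' 0 <= W,
  forall j, j < scal s' 10 -> scal s' 0 <= dst j &
  k <= k' + 30 * scal s' 10].
apply: (run_while (I := I)); first by rewrite /I i0; split=> //; lia.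
move=> k' s' [eqa le [ex0' sW'] minj lek'] /=; split; first by lia.
rewrite eqa s01; case: ifP => [lt|/negbT]; last first.
  by rewrite -leqNgt => ge; apply: post => // j jn; apply: minj; exact: leq_trans ge.
apply: wpP => /=; rewrite eqa /upd /= d9 // subn1 /=.
split; first by lia.
case: ifP => cmp.
  split; [lia|lia|split; [lia|lia|]].
  rewrite /I /= /upd /=; split=> //; [lia| |by move=> j; rewrite addn1 ltnS leq_eqVlt => /predU1P[->//|/minj]; lia|lia].
  by split; [exists (scal s' 10)|lia].
split; [lia|split; [lia|lia|]].
rewrite /I /= /upd /=; split=> //; [lia| |lia].
by move=> j; rewrite addn1 ltnS leq_eqVlt => /predU1P[->|/minj//]; lia.
Qed.

(** Array 10 is initially zero, so setting the tail to 1 enqueues ranking 0. The minimum starts from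
    the distance of that ranking, hence from an attained value. *)
Definition program : cmd :=
  Then positions_loop
  (Then swap_loop
  (Then (Write 9 (Const 0) (Plus (Var 4) (Const 1)))
  (Then (Assign 6 (Const 1))
  (Then search_loop
  (Then (Assign 0 (Var 4)) min_loop))))).

(** The graph hypothesis speaks of later states, since [sg_step] reads array 7, which the first loop
    fills. *)
Lemma program_run W k s m n dst (u v : 'S_m) :
  arr s 0 0 = m -> arr s 0 1 = n ->
  (forall i : 'I_m, arr s 1 i = val (v^-1 i)%g) ->
  (forall i : 'I_m, arr s 2 i = val (u^-1 i)%g) ->
  (forall x, scal s x = 0) -> (forall a i, 6 < a -> arr s a i = 0) ->
  (forall s', (forall a, a < 7 -> arr s' a = arr s a) ->
     (forall c : 'I_m, arr s' 7 c = v c) -> search_graph W s' n dst) ->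
  0 < n -> dst 0 = swap u v -> arr s 3 0 = 0 -> m * m + m <= W ->
  100 * (m * m) + 100 * m + 100 * n + 40 * arr s 3 n + 100 <= k ->
  run W k program s (fun _ s' =>
    (exists2 j, j < n & output s' = dst j) /\
    (forall j, j < n -> output s' <= dst j)).
Proof.
move=> s00 s01 s1 s2 sc0 ar0 G n0 dst0 off0 mW lek.
apply: run_then; apply: (positions_run (m := m) (u := u) (v := v)) => //; [lia|lia|].
move=> k1 t1 lek1 ta1 tx1 t17 t18.
apply: run_then; apply: (swap_run (m := m) (u := u) (v := v)) => //.
- by rewrite ta1.
- by rewrite tx1.
- by rewrite tx1.
- by lia.
move=> k2 t2 lek2 ta2 tx2 t24.
(* The phases that follow write only to arrays 9 and 10, so the graph description persists. *)
have G2 t : (forall a, a < 9 -> arr t a = arr t2 a) -> search_graph W t n dst.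
  move=> eqt; apply: G => [a lt|c].
    by rewrite eqt ?ta2 ?ta1 ?lt // ltnW // ltnW.
  by rewrite eqt // ta2.
have nW := sg_size (G2 t2 (fun _ _ => erefl)).
have dW := sg_value (G2 t2 (fun _ _ => erefl)) n0; rewrite dst0 in dW.
have t2_0 x : x \notin [:: 1; 2; 3; 4] -> scal t2 x = 0.
  by rewrite inE negb_or => /andP[x1 nx]; rewrite tx2 ?tx1.
apply: wpP => /=; rewrite t24.
split; [lia|lia|lia|split; [lia|lia|]].
apply: (search_run (n := n) (dst := dst)) => //=.
- by apply: G2 => a lt; rewrite /= /upd ltn_eqF.
- by rewrite /upd /= t2_0.
- by rewrite /upd /= ta2 ta1 // ar0.
- by move=> j _; rewrite /upd /= ta2 ta1 // ar0 // addn1 -dst0; case: eqP => // ->.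
- by rewrite /upd /= ta2 ta1.
- by rewrite /upd /= ta2 ta1 //; lia.
move=> k3 t3 lek3 ta3 tx3 t39.
have t34 : scal t3 4 = swap u v by rewrite tx3.
have e3 : upd (arr t2) 9 (upd (arr t2 9) 0 (swap u v + 1)) 3 n = arr s 3 n.
  by rewrite /upd /= ta2 ta1.
rewrite e3 in lek3; rewrite t34; split; [lia|lia|].
apply: (min_run (n := n) (dst := dst)) => //=.
- by rewrite ta3 //= /upd /= ta2 ta1.
- by rewrite /upd /= tx3 //= /upd /= t2_0.
- by exists 0.
- by rewrite /upd /=; lia.
- by lia.
Qed.

(** * Euclidean domains *)

Section EuclideanOrders.

Import Order.TTheory GRing.Theory Num.Theory.

(** The position of a candidate is the number of candidates with a smaller key. *)
Lemma rank_by_key (R : realDomainType) m (f : 'I_m -> R) :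
  injective f -> exists w : 'S_m, forall a b, ahead w a b = (f a < f b)%R.
Proof.
move=> injf; pose below c := [set e | (f e < f c)%R].
have ltm c : #|below c| < m.
  rewrite -[X in _ < X]card_ord -cardsT; apply: proper_card.
  by apply/properP; split; [exact: subsetT | exists c; rewrite ?inE ?ltxx].
pose g c := Ordinal (ltm c).
have ltg a b : (f a < f b)%R -> g a < g b.
  move=> ab; apply: proper_card; apply/properP; split.
    by apply/subsetP=> e; rewrite !inE => /lt_trans->.
  by exists a; rewrite ?inE ?ltxx.
have injg : injective g.
  move=> a b eqg; apply: injf; case: (ltgtP (f a) (f b)) => // /ltg;
  by rewrite eqg ltnn.
exists (perm injg) => a b; rewrite /ahead !permE.
case: (ltgtP (f a) (f b)) => [/ltg//|/ltg|/injf->]; last by rewrite ltnn.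
by move=> lt; apply/negbTE; rewrite -leqNgt ltnW.
Qed.

(** The [size p] distinct points [e / (k + 1)] outnumber the roots of [p]. *)
Lemma nonroot_near0 (R : realFieldType) (p : {poly R}) (e : R) :
  (p != 0)%R -> (0 < e)%R -> exists t : R, [/\ (0 < t)%R, (t <= e)%R & ~~ root p t].
Proof.
move=> p0 e0; pose ts := [seq (e / k.+1%:R)%R | k <- iota 0 (size p)].
have uts : uniq ts.
  rewrite map_inj_uniq ?iota_uniq // => i j /(mulfI (lt0r_neq0 e0))/invr_inj.
  by move/eqP; rewrite eqr_nat eqSS => /eqP.
have /allPn[t] : ~~ all (root p) ts.
  apply/negP=> /(max_poly_roots p0)/(_ uts).
  by rewrite size_map size_iota ltnn.
case/mapP=> k _ -> nr; exists (e / k.+1%:R)%R; split=> //.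
  by rewrite divr_gt0 ?ltr0n.
by rewrite ler_pdivrMr ?ltr0n // ler_peMr ?ler1n // ltW.
Qed.

Definition sqdist (R : realType) d (y z : 'rV[R]_d) : R :=
  (\sum_(i < d) (y 0 i - z 0 i) ^+ 2)%R.

Lemma sqdist_ge0 (R : realType) d (y z : 'rV[R]_d) : (0 <= sqdist y z)%R.
Proof. by apply: sumr_ge0 => i _; exact: sqr_ge0. Qed.

Lemma edist_lt (R : realType) d (y z y' z' : 'rV[R]_d) :
  (edist y z < edist y' z')%R = (sqdist y z < sqdist y' z')%R.
Proof.
rewrite /edist -!/(sqdist _ _); case: (ltgtP (sqdist y' z') 0)%R => h.
- by have := sqdist_ge0 y' z'; rewrite leNgt h.
- by rewrite ltr_sqrt.
- by rewrite h sqrtr0 !ltNge sqrtr_ge0 sqdist_ge0.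
Qed.

Lemma sqdistxx (R : realType) d (y : 'rV[R]_d) : sqdist y y = 0%R.
Proof. by rewrite /sqdist big1 // => i _; rewrite subrr expr0n. Qed.

Lemma sqdist_gt0 (R : realType) d (y z : 'rV[R]_d) :
  y != z -> (0 < sqdist y z)%R.
Proof.
move=> yz; rewrite lt_def sqdist_ge0 andbT; apply: contra yz => /eqP s0.
have := psumr_eq0P (fun i _ => sqr_ge0 (y 0 i - z 0 i))%R s0.
move=> h; apply/eqP/rowP=> i; move/(_ i isT)/eqP: h.
by rewrite sqrf_eq0 subr_eq0 => /eqP.
Qed.

(* The bisector of two points meets the moment curve through [z] in the zeros
   of a nonzero polynomial. *)
Definition moment_point (R : realType) d (z : 'rV[R]_d) (t : R) : 'rV[R]_d :=
  (\row_i (z 0 i + t ^+ i.+1))%R.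

(** The squares of the powers of [t] cancel in the difference of squared distances. [insub] turns an
    index into a coordinate; its failure branch is not reached below [d]. *)
Definition bisector_poly (R : realType) d (z x y : 'rV[R]_d) : {poly R} :=
  ((sqdist z x - sqdist z y)%:P +
   'X * \poly_(i < d) (if insub i is Some j then 2%:R * (y 0 j - x 0 j) else 0))%R.

Lemma horner_bisector_poly (R : realType) d (z x y : 'rV[R]_d) t :
  ((bisector_poly z x y).[t] =
   sqdist (moment_point z t) x - sqdist (moment_point z t) y)%R.
Proof.
rewrite /bisector_poly hornerD hornerC hornerM hornerX horner_poly /sqdist.
rewrite -!sumrB mulr_sumr -big_split /=; apply: eq_bigr => i _.
by rewrite valK !mxE (exprS t i); ring.
Qed.

(** Each coordinate has its own power of [t], so the coefficient of degree [i + 1] is twice the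
    difference of the points in coordinate [i]. *)
Lemma bisector_poly_neq0 (R : realType) d (z x y : 'rV[R]_d) :
  x != y -> bisector_poly z x y != 0%R.
Proof.
move=> xy; apply: contra xy => /eqP p0; apply/eqP/rowP=> i.
have : ((bisector_poly z x y)`_i.+1 = 0)%R by rewrite p0 coef0.
rewrite coefD coefC mulrC coefMX /= add0r coef_poly ltn_ord valK => h; lra.
Qed.

Lemma horner_neg_near0 (R : realFieldType) (p : {poly R}) :
  (p.[0] < 0)%R ->
  exists2 e : R, (0 < e)%R & forall t, (0 < t <= e)%R -> (p.[t] < 0)%R.
Proof.
move=> p0; pose M := (\sum_(i < size p) `|p`_i|)%R.
have M0 : (0 <= M)%R by apply: sumr_ge0.
(* For [0 < t <= 1] the value at [t] is at most [p.[0] + t * M]; the second bound gives [t * (M + 1)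
   <= - p.[0]], which makes this at most [- t]. *)
exists (Num.min 1 (- p.[0] / (M + 1)))%R.
  by rewrite lt_min ltr01 divr_gt0 // ?oppr_gt0 // ltr_wpDl.
move=> t /andP[t0]; rewrite le_min ler_pdivlMr ?ltr_wpDl // => /andP[t1 tM].
suff : (p.[t] <= p.[0] + t * M)%R by lra.
have size0 : size p != 0.
  by apply: contraTneq p0 => /eqP; rewrite size_poly_eq0 => /eqP->; rewrite horner0 ltxx.
rewrite /M !horner_coef; case: (size p) size0 => // n _.
rewrite !big_ord_recl /= !expr0 [X in (_ + X + _)%R]big1 => [|i _]; last first.
  by rewrite expr0n mulr0.
rewrite addr0 lerD2l mulrDr mulr_sumr -[leLHS]add0r lerD //.
  by rewrite mulr_ge0 // ltW.
apply: ler_sum => i _; rewrite /bump add1n exprSr mulrA mulrC.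
rewrite ler_pM2l // (le_trans (ler_norm _)) // normrM ler_piMr //.
rewrite ger0_norm ?exprn_ge0 ?exprn_ile1 // ltW //.
Qed.

(** A small [t] that is no root of the product of all bisector polynomials avoids every tie at once.
    At [t = 0] the voter sits on [x a], so for small [t] the sign keeps [a] ahead of [b]. *)
Lemma generic_point (R : realType) d m (x : 'I_m -> 'rV[R]_d) a b :
  injective x -> a != b ->
  exists y, injective (fun c => sqdist y (x c)) /\
            (sqdist y (x a) < sqdist y (x b))%R.
Proof.
move=> injx ab; pose z := x a.
pose q := (\prod_(p : 'I_m * 'I_m | p.1 != p.2)
             bisector_poly z (x p.1) (x p.2))%R.
have q0 : (q != 0)%R.
  apply/prodf_neq0 => p np; apply: bisector_poly_neq0.
  by apply: contra_neq np => /injx.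
have at0 : ((bisector_poly z (x a) (x b)).[0] < 0)%R.
  rewrite horner_bisector_poly.
  have -> : moment_point z 0 = z by apply/rowP=> i; rewrite mxE expr0n addr0.
  by rewrite sqdistxx sub0r oppr_lt0 sqdist_gt0 // /z; apply: contra_neq ab => /injx.
have [e e0 neg] := horner_neg_near0 at0.
have [t [t0 te nr]] := nonroot_near0 q0 e0.
exists (moment_point z t); split; last first.
  by rewrite -subr_lt0 -horner_bisector_poly neg // t0.
move=> c c' /= eqd; apply/eqP; apply: contraNT nr => cc'.
rewrite /q (bigD1 (c, c')) //= rootM; apply/orP; left.
by rewrite /root horner_bisector_poly eqd subrr.
Qed.

Lemma Euclidean_both_orders (R : realType) d m (D : {set 'S_m}) a b :
  is_Euclidean R d D -> a != b -> exists2 u, u \in D & ahead u a b.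
Proof.
case=> x [injx DP] ab; have [y [injy yab]] := generic_point injx ab.
have [w wP] := rank_by_key injy; exists w; last by rewrite wP.
by apply/DP; exists y => a' b'; rewrite wP edist_lt.
Qed.

(** With at most one candidate there is no pair for [Euclidean_both_orders], but then any point
    induces the only ranking. *)
Lemma Euclidean_neq0 (R : realType) d m (D : {set 'S_m}) :
  is_Euclidean R d D -> D != set0.
Proof.
move=> ED; have [m1|m1] := leqP m 1; last first.
  have [|u Du _] := Euclidean_both_orders (a := Ordinal (ltnW m1))
                      (b := Ordinal m1) ED; first by [].
  by apply/set0Pn; exists u.
case: ED => x [_ DP]; apply/set0Pn; exists 1%g; apply/DP; exists 0%R => a b.
by rewrite /ahead !perm1; have := ltn_ord a; have := ltn_ord b; lia.
Qed.

End EuclideanOrders.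

(** * The stored tree *)

Lemma size_listing m (v : 'S_m) : size (listing v) = m.
Proof. by rewrite size_map size_enum_ord. Qed.

Lemma nth_listing m (v : 'S_m) (i : 'I_m) : nth 0 (listing v) i = val (v^-1 i)%g.
Proof. by rewrite (nth_map i) ?size_enum_ord // nth_ord_enum. Qed.

Lemma nth_offsets ns i : i <= size ns -> nth 0 (offsets ns) i = sumn (take i ns).
Proof. by move=> le; rewrite (nth_map 0) ?size_iota // nth_iota. Qed.

Lemma sumn_take_shape (T : Type) (ss : seq (seq T)) i : i < size ss ->
  sumn (take i.+1 (shape ss)) = sumn (take i (shape ss)) + size (nth [::] ss i).
Proof.
move=> lt; rewrite (take_nth 0) ?size_map // sumn_rcons.
by rewrite (nth_map [::]).
Qed.

Lemma nth_flatten_block (T : Type) x0 (ss : seq (seq T)) i c :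
  c < size (nth [::] ss i) ->
  nth x0 (flatten ss) (sumn (take i (shape ss)) + c) = nth x0 (nth [::] ss i) c.
Proof.
move=> lt; have lt' : c < nth 0 (shape ss) i.
  have [ge|lti] := leqP (size ss) i; first by rewrite nth_default in lt.
  by rewrite (nth_map [::]).
by rewrite nth_flatten -/(flatten_index _ _ _) flatten_indexKl // flatten_indexKr.
Qed.

(** For [m >= 2] both follow from [m <= m * m.-1]; smaller [m] rely on [0 < n]. *)
Lemma pairs_bound m n : m * m.-1 <= 2 * n -> 0 < n -> m <= 2 * n /\ m * m <= 4 * n.
Proof. by case: m => [|[|m]] /=; nia. Qed.

Section StoredTree.
Variables (m : nat) (D : {set 'S_m}) (T : rel 'S_m) (X : tree_data m).
Hypotheses (treeD : is_swap_tree D T) (storesX : stores X D T).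

Let node i := nth 1%g (verts X) i.
Let off i := sumn (take i (shape (arcs X))).

Lemma size_verts : size (verts X) = #|D|.
Proof.
case: storesX => uX XD _ _; rewrite -(card_uniqP uX).
exact: eq_card XD.
Qed.

Lemma size_nth_arcs i : i < #|D| ->
  size (nth [::] (arcs X) i) = #|[pred w | T (node i) w]|.
Proof.
rewrite -size_verts; case: storesX => _ _ _ stX lt.
by have [/perm_size] := stX i lt; rewrite size_map -cardE.
Qed.

Lemma nth_arcsP i j a b : i < #|D| -> (j, (a, b)) \in nth [::] (arcs X) i ->
  [/\ j < #|D|, T (node i) (node j), ahead (node i) a b & ahead (node j) b a].
Proof.
rewrite -size_verts; case: storesX => _ _ _ stX lt inL.
have [/perm_mem perm_nb /(_ j a b inL)[ltj ahi ahj]] := stX i lt.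
split=> //; have := perm_nb (node j); rewrite mem_enum inE => <-.
by apply/mapP; exists (j, (a, b)).
Qed.

Lemma nth_arcs_nbr i w : i < #|D| -> T (node i) w ->
  exists2 x, x \in nth [::] (arcs X) i & w = node x.1.
Proof.
rewrite -size_verts; case: storesX => _ _ _ stX lt Tw.
have [/perm_mem/(_ w)] := stX i lt; rewrite mem_enum inE Tw => /mapP[x xL ->] _.
by exists x.
Qed.

(** [off #|D|] is the total length of the adjacency lists: the forest bound limits it from above,
    the number of ordered pairs from below. *)
Lemma sum_degrees : off #|D| = \sum_(u in D) #|[pred w | T u w]|.
Proof.
have [uX XD sz _] := storesX.
rewrite /off take_oversize; last by rewrite size_map sz size_verts.
rewrite sumnE big_map (big_nth [::]) sz size_verts.
rewrite (eq_big_nat _ _ (F2 := fun i => #|[pred w | T (node i) w]|)); last first.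
  by move=> i lt; rewrite size_nth_arcs.
rewrite -size_verts -(big_nth 1%g xpredT (fun u => #|[pred w | T u w]|)).
by rewrite big_uniq //; apply: eq_bigl => u; exact: XD.
Qed.

Lemma sum_degrees_le : off #|D| <= #|D|.*2.
Proof.
have [[symT irrT TD _ acT] _] := treeD.
rewrite sum_degrees; apply: leq_trans (acyclic_degree_sum D symT irrT acT).
apply: leq_sum => u _; apply/subset_leq_card/subsetP=> w; rewrite !inE => Tuw.
by have /andP[_ ->] := TD _ _ Tuw.
Qed.

Lemma sum_degrees_card : off #|D| = #|[set e : 'S_m * 'S_m | T e.1 e.2]|.
Proof.
have [[_ _ TD _ _] _] := treeD.
rewrite sum_degrees -sum1_card [RHS]big_mkcond.
transitivity (\sum_u \sum_w if T u w then 1 else 0).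
  rewrite big_mkcond; apply: eq_bigr => u _; case: ifPn => uD.
    by rewrite -big_mkcond sum1_card.
  rewrite big1 // => w _; case: ifP => // /TD; by rewrite (negbTE uD).
by rewrite pair_bigA; apply: eq_bigr => e _; rewrite inE.
Qed.

Lemma offS i : i < #|D| -> off i.+1 = off i + size (nth [::] (arcs X) i).
Proof.
by move=> lt; rewrite /off sumn_take_shape //; case: storesX => _ _ ->; rewrite size_verts.
Qed.

Lemma off_le i : off i <= off #|D|.
Proof.
have [_ _ sz _] := storesX.
rewrite [leqRHS]/off take_oversize; last by rewrite size_map sz size_verts.
by rewrite -[X in _ <= sumn X](cat_take_drop i) sumn_cat leq_addr.
Qed.

Lemma input_off v i : i <= #|D| -> arr (input v X) 3 i = off i.
Proof.
by move=> le; rewrite /= nth_offsets // size_map; case: storesX => _ _ ->; rewrite size_verts.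
Qed.

Lemma input_arc v i e : i < #|D| -> off i <= e < off i.+1 ->
  exists j a b, [/\ (j, (a, b)) \in nth [::] (arcs X) i,
    arr (input v X) 4 e = j, arr (input v X) 5 e = a & arr (input v X) 6 e = b].
Proof.
move=> lti; rewrite offS // => /andP[le lt].
have ltc : e - off i < size (nth [::] (arcs X) i) by lia.
have [x0 x0L] : exists x0, x0 \in nth [::] (arcs X) i.
  by case: (nth _ _ _) ltc => // x0 l _; exists x0; rewrite mem_head.
have blk := nth_flatten_block x0 ltc; rewrite -/(off i) subnKC // in blk.
have lte : e < size (flatten (arcs X)).
  rewrite size_flatten; apply: leq_trans (_ : off i.+1 <= _); first by rewrite offS.
  apply: leq_trans (off_le _) _; rewrite /off take_oversize // size_map.
  by case: storesX => _ _ ->; rewrite size_verts.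
have := mem_nth x0 ltc; rewrite -blk.
case def_x: (nth x0 (flatten (arcs X)) e) => [j [a b]] inL.
by exists j, a, b; split=> //=; rewrite (nth_map x0) // def_x.
Qed.

Lemma input_arc_in v i x : i < #|D| -> x \in nth [::] (arcs X) i ->
  exists2 e, off i <= e < off i.+1 & arr (input v X) 4 e = x.1.
Proof.
move=> lti xL; have ltc := xL; rewrite -index_mem in ltc.
exists (off i + index x (nth [::] (arcs X) i)); first by rewrite offS // leq_addr ltn_add2l.
rewrite /= (nth_map x) ?nth_flatten_block ?nth_index //.
rewrite size_flatten; apply: leq_trans (_ : off i.+1 <= _); first by rewrite offS // ltn_add2l.
apply: leq_trans (off_le _) _; rewrite /off take_oversize // size_map.
by case: storesX => _ _ ->; rewrite size_verts.
Qed.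

(** Here the tree meets the arrays: [swap_step] gives the change of distance along an arc, and
    connectedness of the tree gives the closure principle. *)
Lemma input_search_graph W v s :
  (forall a, a < 7 -> arr s a = arr (input v X) a) ->
  (forall c : 'I_m, arr s 7 c = v c) -> 0 < #|D| -> 2 * #|D| + m * m < W ->
  search_graph W s #|D| (fun j => swap (node j) v).
Proof.
move=> eqs pv D0 leW.
have [uX XD _ _] := storesX.
have [[_ _ TD conT _] T1] := treeD.
have in_range i : i < #|D| -> arr s 3 i = off i /\ arr s 3 i.+1 = off i.+1.
  by move=> lt; rewrite eqs // !input_off // ltnW.
split.
- by lia.
- move=> i lt; have [-> ->] := in_range i lt; rewrite offS // leq_addr /=.
  by rewrite -offS //; have := off_le i.+1; have := sum_degrees_le; lia.
- move=> i e lt; have [-> ->] := in_range i lt => le; rewrite eqs //.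
  have [j [a [b [inL -> _ _]]]] := input_arc v lt le.
  by have [] := nth_arcsP lt inL.
- move=> i e lt; have [-> ->] := in_range i lt => le; rewrite (eqs 4) ?(eqs 5) ?(eqs 6) //.
  have [j [a [b [inL -> -> ->]]]] := input_arc v lt le.
  have [ltj Tij aij aji] := nth_arcsP lt inL.
  by have := swap_step v (T1 _ _ Tij) aij aji; rewrite !pv.
- move=> j _; have := swap_le_bin (node j) v; rewrite bin2.
  have : m * m.-1 <= m * m by rewrite leq_mul2l leq_pred orbT.
  by move: leW; lia.
move=> S S0 closed j ltj; apply/negPn/negP=> nSj.
have inD i : i < #|D| -> node i \in D.
  by rewrite -size_verts -XD; exact: mem_nth.
have idx i : i < #|D| -> index (node i) (verts X) = i.
  by rewrite -size_verts => lt; rewrite index_uniq.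
(* If [S] missed [j], some tree edge would leave [S]; as it is stored as an arc, this contradicts
   closure. *)
have [||x [y [Txy Sx nSy]]] := connect_cut (P := fun w => S (index w (verts X)))
  (conT _ _ (inD 0 D0) (inD j ltj)).
- by rewrite idx.
- by rewrite idx.
have /andP[Dx _] := TD _ _ Txy; rewrite -XD -index_mem size_verts in Dx.
have nx : node (index x (verts X)) = x by rewrite /node nth_index // -index_mem size_verts.
rewrite -nx in Txy; have [[j' [a b]] inL ey] := nth_arcs_nbr Dx Txy.
have [ltj' _ _ _] := nth_arcsP Dx inL.
have [e le etgt] := input_arc_in v Dx inL.
move: nSy; rewrite ey idx // => /negP; apply.
rewrite -[j']etgt -eqs //; apply: (closed _ _ Dx Sx).
by have [-> ->] := in_range _ Dx.
Qed.

(** With [m * m <= 4 * #|D|], [m <= 2 * #|D|] and at most [2 * #|D|] arcs, the budget of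
    [program_run] is at most (400 + 200 + 100 + 80 + 100) times [#|D|], hence 900. The same number
    serves as word bound. *)
Lemma program_correct v : 0 < #|D| -> m * m.-1 <= off #|D| ->
  exists s t, [/\ exec (900 * #|D|) program (input v X) s t,
    output s = swap_dom D v & t <= 900 * #|D|].
Proof.
move=> D0 mm; have le2 := sum_degrees_le.
have [mD mmD] : m <= 2 * #|D| /\ m * m <= 4 * #|D|.
  by apply: pairs_bound D0; rewrite mul2n (leq_trans mm).
have [uX XD sz _] := storesX.
have node_D j : j < #|D| -> node j \in D.
  by rewrite -size_verts -XD; exact: mem_nth.
have [||||||||||||s [t [ex le [[j ltj out] minout]]]] :=
  @program_run (900 * #|D|) (900 * #|D|) (input v X) m #|D|
    (fun j => swap (node j) v) (node 0) v.
- by [].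
- by rewrite /= size_verts.
- by move=> i; rewrite /= nth_listing.
- move=> i; rewrite /= /node; move: D0; rewrite -size_verts.
  by case: (verts X) => // u l _; rewrite /= nth_cat size_listing ltn_ord nth_listing.
- by [].
- by do 7 case=> //; move=> a i _; rewrite /= !nth_nil.
- by move=> s' eqs pv; apply: (input_search_graph eqs pv) => //; lia.
- by [].
- by [].
- by rewrite input_off // /off take0.
- by lia.
- by rewrite input_off //; lia.
exists s, t; split=> //; apply: swap_domP; first by exists (node j); [exact: node_D|].
move=> u uD; rewrite -XD in uD; have uD' := uD.
rewrite -index_mem size_verts in uD'.
by have := minout _ uD'; rewrite /node nth_index.
Qed.

End StoredTree.

Theorem theorem4p9 (R : realType) :
  exists P : cmd,
  forall d : nat, 0 < d ->
  exists c : nat,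
  forall (m : nat) (D : {set 'S_m}) (T : rel 'S_m) (X : tree_data m)
    (v : 'S_m),
  (is_SC D /\ is_path D T) \/ is_Euclidean R d D ->
  is_swap_tree D T ->
  stores X D T ->
  exists (s : state) (t : nat),
    [/\ exec (c * #|D|) P (input v X) s t,
        output s = swap_dom D v
      & t <= c * #|D|].
Proof.
exists program => d _; exists 900 => m D T X v domD treeD storesX.
(* Both kinds of domain supply two facts: each pair occurs in both orders, which bounds [m * m.-1]
   by the number of arcs, and [D] is nonempty, which lets [#|D|] absorb additive constants. *)
have both a b : a != b -> exists2 u, u \in D & ahead u a b.
  case: domD => [[SCD _]|ED]; first exact: SC_both_orders.
  exact: Euclidean_both_orders ED.
have D0 : 0 < #|D|.
  case: domD => [[[s [p [_ _ ->]]] _]|/Euclidean_neq0]; last by rewrite card_gt0.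
  by apply/card_gt0P; exists (s 0); apply/imsetP; exists ord0.
apply: (program_correct treeD storesX v D0).
by rewrite (sum_degrees_card treeD storesX) (swap_tree_card treeD).
Qed.
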